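(* For $i=1,2$ let $D(g_i)\subset\mathbb{R}$ and let $g_i:D(g_i)\to\mathbb{R}$ be a continuous $T_i$-periodic function whose restriction $g_i|_{\operatorname{int}D(g_i)}$ to the interior of its domain is nonconstant (in particular, $\operatorname{int}D(g_i)\neq\emptyset$). Assume $D(g_1)\cap D(g_2)\neq\emptyset$. Then the product $g_1g_2$, defined on $D(g_1)\cap D(g_2)$, is periodic if and only if the periods $T_1$ and $T_2$ are commensurable.
   Context: A function $f$ with domain $D\subset\mathbb{R}$ is called periodic (or $T$-periodic) if, for some real $T\neq0$, $D+T=D$ and $f(x+T)=f(x)$ for all $x\in D$; then $T$ is called a period of $f$. Periods are assumed positive. Two nonzero real numbers are commensurable if their ratio is rational. The product of functions with possibly different domains is defined on the intersection of the domains. Continuity is with respect to the subspace topology on the domain. *)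

(* Defs.v *)
From mathcomp Require Import all_boot all_order all_algebra.
From mathcomp Require Import all_classical all_reals all_analysis.

Set Implicit Arguments.
Unset Strict Implicit.
Unset Printing Implicit Defensive.

Import Order.TTheory GRing.Theory Num.Theory.
Import numFieldNormedType.Exports.

Local Open Scope classical_set_scope.
Local Open Scope ring_scope.

(* A function with domain D is a pair of a set D and a total f : R -> R; no
   definition below depends on the values of f outside D. *)

Definition has_period (R : realType) (D : set R) (f : R -> R) (T : R) : Prop :=
  [/\ T != 0, [set x + T | x in D] = D & forall x, D x -> f (x + T) = f x].

Definition periodic_on (R : realType) (D : set R) (f : R -> R) : Prop :=
  exists T : R, has_period D f T.

Definition nonconstant_on (R : realType) (A : set R) (f : R -> R) : Prop :=
  exists x y : R, [/\ A x, A y & f x <> f y].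

Definition commensurable (R : realType) (a b : R) : Prop :=
  [/\ a != 0, b != 0 & rational (a / b)].

(* Main.v *)
(* Suppose T is a period of g1 g2 while T1 / T2 is irrational. Passing to
   interiors, D1 and D2 may be assumed open. By Kronecker's theorem every orbit
   x + Z T1 meets D2, so D1, and likewise D2, is T-invariant, and density
   together with continuity gives g1(u + T) g2(v + T) = g1(u) g2(v) for all
   u in D1 and v in D2. Since T is incommensurable with one of the two periods,
   say T1, the open set D1 is the whole line, and g1(u + T) = c g1(u) for a
   constant c. As |g1| attains a positive maximum, |c| = 1, so 2T is a period of
   g1 incommensurable with T1, which makes g1 constant. *)

Require Import Defs.
From mathcomp Require Import all_boot all_order all_algebra.
From mathcomp Require Import all_classical all_reals all_analysis.
From mathcomp Require Import ring lra.

Set Implicit Arguments.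
Unset Strict Implicit.
Unset Printing Implicit Defensive.

Import Order.TTheory GRing.Theory Num.Theory.
Import numFieldNormedType.Exports.

Local Open Scope classical_set_scope.
Local Open Scope ring_scope.

(** * Commensurability, and density of the group generated by two incommensurable reals *)

Lemma commensurable_sym (R : realType) (a b : R) :
  commensurable a b -> commensurable b a.
Proof.
move=> [a0 b0 [q _ qE]]; split => //.
by exists q^-1 => //; rewrite fmorphV /= qE invf_div.
Qed.

Lemma commensurable_trans (R : realType) (b a c : R) :
  commensurable a b -> commensurable b c -> commensurable a c.
Proof.
move=> [a0 b0 [q _ qE]] [_ c0 [r _ rE]]; split => //.
by exists (q * r) => //; rewrite rmorphM /= qE rE mulrA divfK.
Qed.

(** Otherwise the positive elements of the group [G] generated by [a] and [b] stay away from 0, so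
    [G] is cyclic, and [a] and [b] are integer multiples of one generator. *)
Lemma int_span_small (R : realType) (a b : R) :
  a != 0 -> b != 0 -> ~ commensurable a b ->
  forall e : R, 0 < e -> exists m n : int, 0 < m%:~R * a + n%:~R * b < e.
Proof.
move=> a0 b0 nab e e0; apply: contrapT => small; apply: nab.
pose G := [set x : R | exists m n : int, x = m%:~R * a + n%:~R * b].
have G_sub x y : G x -> G y -> G (x - y).
  move=> [m [n ->]] [k [l ->]]; exists (m - k), (n - l).
  by rewrite !rmorphB /=; ring.
have G_mul (k : int) x : G x -> G (k%:~R * x).
  move=> [m [n ->]]; exists (k * m), (k * n).
  by rewrite !rmorphM /=; ring.
have Ga : G a by exists 1, 0; rewrite mul1r mul0r addr0.
have Gb : G b by exists 0, 1; rewrite mul1r mul0r add0r.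
pose E := [set x | G x /\ 0 < x].
have leE x : E x -> e <= x.
  move=> [[m [n xE]] x0]; rewrite leNgt; apply/negP => xe; apply: small.
  by exists m, n; rewrite -xE x0 xe.
have hE : has_inf E.
  split; last by exists e; exact: leE.
  case: (ltgtP a 0) a0 => // ha _.
    exists (- a); split; last by rewrite oppr_gt0.
    by rewrite -mulN1r; exact: (G_mul (-1)).
  by exists a.
have s0 : 0 < inf E by apply: (lt_le_trans e0); apply: lb_le_inf; [case: hE|exact: leE].
have infE x : E x -> inf E <= x by move=> Ex; apply: ge_inf => //; case: hE.
have [x [Gx x0] xs] := inf_adherent s0 hE.
(* An element of the group left over after division by x < 2 inf E would be
   at least inf E, and so would its complement to x. *)
have mult y : G y -> exists k : int, y = k%:~R * x.
  move=> Gy; exists (Num.floor (y / x)).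
  have /andP[fl fu] := floor_itv (y / x).
  set k := Num.floor _ in fl fu *.
  move: fl; rewrite ler_pdivlMr// => fl.
  move: fu; rewrite ltr_pdivrMr// rmorphD /= mulrDl mul1r => fu.
  apply/eqP; rewrite -subr_eq0 eq_le subr_ge0 fl andbT leNgt.
  apply/negP => r0.
  have Er : E (y - k%:~R * x) by split => //; apply: G_sub => //; exact: G_mul.
  have Er' : E (x - (y - k%:~R * x)).
    by split; [apply: G_sub => //; case: Er | lra].
  have := infE _ Er; have := infE _ Er'; lra.
have [k ak] := mult _ Ga; have [l bl] := mult _ Gb.
split => //; exists (k%:~R / l%:~R) => //.
by rewrite fmorph_div /= !ratr_int ak bl -mulf_div divff ?mulr1// gt_eqF.
Qed.

(** Walking from [x] in steps [d] shorter than the radius of a ball around [y] inside [U], the last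
    point not beyond [y] lies in that ball. *)
Lemma kronecker_dense (R : realType) (a b x : R) (U : set R) :
  a != 0 -> b != 0 -> ~ commensurable a b -> open U -> U !=set0 ->
  exists m n : int, U (x + m%:~R * a + n%:~R * b).
Proof.
move=> a0 b0 nab oU [y Uy].
have /nbhs_ballP[e /= e0 be] : nbhs y U by exact: open_nbhs_nbhs.
have [m [n /andP[d0 de]]] := int_span_small a0 b0 nab e0.
set d := m%:~R * a + n%:~R * b in d0 de.
set k := Num.floor ((y - x) / d).
exists (k * m), (k * n); apply: be; rewrite /ball /=.
have -> : y - (x + (k * m)%:~R * a + (k * n)%:~R * b) = (y - x) - k%:~R * d.
  by rewrite /d !rmorphM /=; ring.
have /andP[] := floor_itv ((y - x) / d); rewrite -/k ler_pdivlMr// => fl.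
rewrite ltr_pdivrMr// rmorphD /= mulrDl mul1r => fu.
by rewrite ger0_norm; lra.
Qed.

(** * Calculus of periods: multiples, products, interiors *)

Lemma has_periodP (R : realType) (D : set R) (f : R -> R) (T : R) :
  has_period D f T <->
  [/\ T != 0, forall x, D (x + T) <-> D x & forall x, D x -> f (x + T) = f x].
Proof.
split=> -[T0 DT fT]; split => //.
  move=> x; rewrite -{1}DT; split=> [[y Dy /addIr <-]//|Dx].
  by exists x.
apply/seteqP; split=> [_ [x Dx <-]|x Dx]; first exact/DT.
by exists (x - T); [apply/DT|]; rewrite subrK.
Qed.

Lemma has_period_mulz (R : realType) (D : set R) (f : R -> R) (T : R) (m : int) :
  has_period D f T ->
  (forall x, D (x + m%:~R * T) <-> D x) /\
  (forall x, D x -> f (x + m%:~R * T) = f x).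
Proof.
move=> /has_periodP[T0 DT fT].
have nat_case (n : nat) : (forall x, D (x + n%:R * T) <-> D x) /\
    (forall x, D x -> f (x + n%:R * T) = f x).
  elim: n => [|n [IHD IHf]]; first by split=> x; rewrite mul0r addr0.
  have SE x : x + n.+1%:R * T = (x + n%:R * T) + T by rewrite -natr1; ring.
  split=> x; rewrite SE; first by rewrite DT.
  by move=> Dx; rewrite fT ?IHf//; apply/IHD.
case: m => n; first exact: nat_case.
have [nD nf] := nat_case n.+1.
have NE x : x + (Negz n)%:~R * T + n.+1%:R * T = x.
  by rewrite NegzE rmorphN /=; ring.
have DE x : D (x + (Negz n)%:~R * T) <-> D x by rewrite -nD NE.
by split=> // x Dx; rewrite -nf ?NE//; apply/DE.
Qed.

Lemma has_period_scale (R : realType) (D : set R) (f : R -> R) (T : R) (m : int) :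
  m != 0 -> has_period D f T -> has_period D f (m%:~R * T).
Proof.
move=> m0 pT; have [DT fT] := has_period_mulz m pT; apply/has_periodP; split => //.
by case: pT => T0 _ _; rewrite mulf_neq0// intr_eq0.
Qed.

Lemma has_periodM (R : realType) (D1 D2 : set R) (f g : R -> R) (T : R) :
  has_period D1 f T -> has_period D2 g T -> has_period (D1 `&` D2) (f \* g) T.
Proof.
move=> /has_periodP[T0 D1T fT] /has_periodP[_ D2T gT].
apply/has_periodP; split => //.
  by move=> x; split=> -[/D1T ? /D2T ?].
by move=> x [D1x D2x] /=; rewrite fT// gT.
Qed.

Lemma has_periodMC (R : realType) (D1 D2 : set R) (f g : R -> R) (T : R) :
  has_period (D1 `&` D2) (f \* g) T -> has_period (D2 `&` D1) (g \* f) T.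
Proof.
by rewrite setIC (_ : g \* f = f \* g)//; apply/funext => x /=; rewrite mulrC.
Qed.

Lemma has_period_interior (R : realType) (D : set R) (f : R -> R) (T : R) :
  has_period D f T -> has_period D° f T.
Proof.
move=> /has_periodP[T0 DT fT].
(* Stated for any shift [S], since the two directions need [T] and [- T]. *)
have sub (S : R) : (forall x, D (x + S) <-> D x) -> forall x, D° (x + S) -> D° x.
  move=> DS x; rewrite /interior => xD.
  have cS : {for x, continuous (fun y : R => y + S)}.
    by apply: continuousD; [exact: cvg_id|exact: cst_continuous].
  by apply: (@filterS _ (nbhs x) _ _ _ _ (cS _ xD)) => y /= /DS.
apply/has_periodP; split => //; last by move=> x /interior_subset; exact: fT.
move=> x; split; first exact: sub.
move=> Dx; apply: (sub (- T)); last by rewrite addrK.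
by move=> y; rewrite -DT subrK.
Qed.

(** * Periodic continuous functions on the whole line *)

(** The translates of [y] by both periods are dense, so they would meet the open set where [f]
    differs from [f y]. *)
Lemma incommensurable_periods_constant (R : realType) (f : R -> R) (a b : R) :
  continuous f -> has_period setT f a -> has_period setT f b ->
  ~ commensurable a b -> forall x y, f x = f y.
Proof.
move=> cf pa pb nab x y; apply: contrapT => fxy.
have oU : open [set z | f z != f y].
  apply: (@open_comp _ _ f [set t | t != f y]) => [? _|]; first exact: cf.
  exact: open_neq.
have [] := kronecker_dense y _ _ nab oU; first by case: pa.
- by case: pb.
- by exists x; exact/eqP.
move=> m [n] /= /eqP; apply.
by rewrite (has_period_mulz n pb).2// (has_period_mulz m pa).2.
Qed.

(** By periodicity [|f|] attains a global maximum, positive here, at some [y]; comparing it with the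
    values at [y + T] and [y - T] bounds [|c|] by 1 from above and from below. *)
Lemma has_period_multiplier_norm (R : realType) (f : R -> R) (P T c : R) :
  continuous f -> 0 < P -> has_period setT f P -> (exists x, f x != 0) ->
  (forall x, f (x + T) = c * f x) -> `|c| = 1.
Proof.
move=> cf P0 pP [x0 fx0] fT.
have [|y _ ymax] := @EVT_max R (fun x => `|f x|) 0 P (ltW P0).
  apply: continuous_subspaceT => x.
  by apply: continuous_comp; [exact: cf|exact: norm_continuous].
have fmax x : `|f x| <= `|f y|.
  pose k := Num.floor (x / P).
  have /andP[] := floor_itv (x / P); rewrite -/k ler_pdivlMr// => fl.
  rewrite ltr_pdivrMr// rmorphD /= mulrDl mul1r => fu.
  have [_ fk] := has_period_mulz (- k) pP.
  rewrite -(fk x)//; apply: ymax.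
  by rewrite in_itv /= rmorphN /=; apply/andP; split; lra.
have fy : 0 < `|f y| by apply: lt_le_trans (fmax x0); rewrite normr_gt0.
apply/eqP; rewrite eq_le; apply/andP; split; rewrite -(ler_pM2r fy) mul1r.
  by rewrite -normrM -fT.
by rewrite -{1}(subrK T y) fT normrM ler_wpM2l.
Qed.

(** * Consequences of a period of the product *)

(** A shift by a multiple of [T1] preserves membership in [D1] and can bring any point into [D2],
    where the invariance of the intersection applies. *)
Lemma has_periodM_domain_left (R : realType) (D1 D2 : set R) (f g : R -> R) (T1 T2 T : R) :
  open D2 -> D2 !=set0 -> ~ commensurable T1 T2 ->
  has_period D1 f T1 -> has_period D2 g T2 ->
  has_period (D1 `&` D2) (f \* g) T ->
  forall x, D1 (x + T) <-> D1 x.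
Proof.
move=> oD2 D20 nT p1 p2 /has_periodP[T0 DT _].
have [[T10 _ _] [T20 _ _]] := (p1, p2).
have meet x : exists m : int, D2 (x + m%:~R * T1).
  have [m [n D2x]] := kronecker_dense x T10 T20 nT oD2 D20.
  by exists m; apply/(has_period_mulz n p2).1.
have swap x (m : int) : x + T + m%:~R * T1 = x + m%:~R * T1 + T by ring.
move=> x; split=> D1x.
  have [m D2xm] := meet (x + T).
  have [D1m _] := has_period_mulz m p1.
  by apply/D1m; have [] : (D1 `&` D2) (x + m%:~R * T1);
    first by apply/DT; rewrite -swap; split => //; exact/D1m.
have [m D2xm] := meet x; have [D1m _] := has_period_mulz m p1.
apply/D1m; rewrite swap.
by have [] : (D1 `&` D2) (x + m%:~R * T1 + T);
  first by apply/DT; split => //; exact/D1m.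
Qed.

(* The orbit of u under T1 is dense modulo T2, so the relation known on the
   diagonal propagates to all pairs. *)
Lemma has_periodM_decouple (R : realType) (D1 D2 : set R) (f g : R -> R) (T1 T2 T : R) :
  open D2 -> (forall x, D2 x -> {for x, continuous g}) ->
  ~ commensurable T1 T2 -> has_period D1 f T1 -> has_period D2 g T2 ->
  (forall x, D1 (x + T) <-> D1 x) -> (forall x, D2 (x + T) <-> D2 x) ->
  has_period (D1 `&` D2) (f \* g) T ->
  forall u v, D1 u -> D2 v -> f (u + T) * g (v + T) = f u * g v.
Proof.
move=> oD2 cg nT p1 p2 D1T D2T /has_periodP[_ _ fgT] u v D1u D2v.
have [[T10 _ _] [T20 _ _]] := (p1, p2).
(* With [u] fixed, [h] is the defect of the identity in the second variable. A nonzero value at [v]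
   would persist nearby, yet [h] vanishes at the points of [D2] of the form [u + m T1 + n T2]. *)
pose h w := f (u + T) * g (w + T) - f u * g w.
have ch : {for v, continuous h}.
  apply: continuousB; apply: continuousM; try exact: cst_continuous; last exact: cg.
  apply: (@continuous_comp _ _ _ (fun w : R => w + T) g).
    by apply: continuousD; [exact: cvg_id|exact: cst_continuous].
  by apply: cg; apply/D2T.
apply/eqP; rewrite -subr_eq0; apply: contrapT => /negP hv.
have nv : nbhs v ([set w | h w != 0] `&` D2).
  apply: filterI; last exact: open_nbhs_nbhs.
  apply: (ch [set t | t != 0]); apply: open_nbhs_nbhs.
  by split; [exact: open_neq|exact: hv].
have [m [n /interior_subset[/= /eqP hw D2w]]] :=
  kronecker_dense u T10 T20 nT (@open_interior _ _) (ex_intro _ v nv).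
apply: hw; rewrite /h.
set z := u + m%:~R * T1 in D2w *.
have [D1m fm] := has_period_mulz m p1; have [D2n gn] := has_period_mulz n p2.
have D2z : D2 z by apply/D2n.
have D1z : D1 z by apply/D1m.
rewrite (_ : z + n%:~R * T2 + T = z + T + n%:~R * T2); last by ring.
rewrite !gn//; last exact/D2T.
rewrite -(fm u)// -(fm (u + T)); last exact/D1T.
rewrite (_ : u + T + m%:~R * T1 = z + T); last by rewrite /z; ring.
by apply/eqP; rewrite subr_eq0; apply/eqP; exact: fgT.
Qed.

(** This is the case of a period [T] incommensurable with that of the first factor; exchanging the
    factors yields the other case. *)
Lemma open_product_not_periodic (R : realType) (D1 D2 : set R) (g1 g2 : R -> R)
    (T1 T2 T : R) :
  0 < T1 -> open D1 -> open D2 ->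
  (forall x, D1 x -> {for x, continuous g1}) ->
  (forall x, D2 x -> {for x, continuous g2}) ->
  nonconstant_on D1 g1 -> nonconstant_on D2 g2 ->
  has_period D1 g1 T1 -> has_period D2 g2 T2 ->
  ~ commensurable T1 T2 -> ~ commensurable T T1 ->
  ~ has_period (D1 `&` D2) (g1 \* g2) T.
Proof.
move=> T10 oD1 oD2 c1 c2 [x1 [y1 [D1x1 D1y1 g1xy]]] [x2 [y2 [D2x2 D2y2 g2xy]]].
move=> p1 p2 n12 nT1 pT.
have T0 : T != 0 by case: pT.
have n21 : ~ commensurable T2 T1 by move=> /commensurable_sym.
have D1T := has_periodM_domain_left oD2 (ex_intro _ x2 D2x2) n12 p1 p2 pT.
have D2T : forall x, D2 (x + T) <-> D2 x.
  apply: (has_periodM_domain_left (g := g1) oD1 (ex_intro _ x1 D1x1) n21 p2 p1).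
  exact: has_periodMC.
have D1E : D1 = setT.
  (* The zero function only serves to express the invariance of [D1] under [T] as a period, so that
     it passes to multiples of [T]. *)
  have pD1 : has_period D1 (cst (0 : R)) T by apply/has_periodP.
  apply/seteqP; split => // x _.
  have [] := kronecker_dense x T0 _ nT1 oD1 (ex_intro _ x1 D1x1); first by rewrite gt_eqF.
  move=> m [n] /(has_period_mulz n p1).1.
  by move=> /(has_period_mulz m pD1).1.
have dec := has_periodM_decouple oD2 c2 n12 p1 p2 D1T D2T pT.
rewrite {}D1E in c1 p1 dec D1x1 D1y1.
have {}c1 : continuous g1 by move=> x; exact: c1.
have [u g1u] : exists u, g1 u != 0.
  have [g1x|] := eqVneq (g1 x1) 0; last by exists x1.
  by exists y1; apply/eqP => g1y; apply: g1xy; rewrite g1x g1y.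
have [v D2v g2v] : exists2 v, D2 v & g2 v != 0.
  have [g2x|] := eqVneq (g2 x2) 0; last by exists x2.
  by exists y2 => //; apply/eqP => g2y; apply: g2xy; rewrite g2x g2y.
have g2vT : g2 (v + T) != 0.
  apply/eqP => g2vT; have /esym/eqP := dec u v I D2v.
  by rewrite g2vT mulr0 mulf_eq0 (negPf g1u) (negPf g2v).
(* Fixing [v] in the decoupled identity produces the constant multiplier. *)
have g1T x : g1 (x + T) = g2 v / g2 (v + T) * g1 x.
  by apply: (mulIf g2vT); rewrite dec//; field.
have cN := has_period_multiplier_norm c1 T10 p1 (ex_intro _ u g1u) g1T.
(* The multiplier may be -1; shifting twice squares it to 1. *)
have p2T : has_period setT g1 (2%:~R * T).
  apply/has_periodP; split => //; first by rewrite mulf_neq0// pnatr_eq0.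
  move=> x _; rewrite (_ : x + _ = x + T + T); last by ring.
  by rewrite !g1T mulrA -expr2 -real_normK ?num_real// cN expr1n mul1r.
have n2T : ~ commensurable (2%:~R * T) T1.
  apply: contra_not nT1; apply: commensurable_trans; split => //.
    by rewrite mulf_neq0// pnatr_eq0.
  by exists 2^-1 => //; rewrite fmorphV rmorph_nat /=; field.
exact: g1xy (incommensurable_periods_constant c1 p2T p1 n2T x1 y1).
Qed.

(** * The equivalence, by a common multiple in one direction and by passing to interiors in the
    other *)

Theorem theorem3 (R : realType) (D1 D2 : set R) (g1 g2 : R -> R) (T1 T2 : R)
  (T1_gt0 : 0 < T1) (T2_gt0 : 0 < T2)
  (g1_cont : {within D1, continuous g1}) (g2_cont : {within D2, continuous g2})
  (g1_per : has_period D1 g1 T1) (g2_per : has_period D2 g2 T2)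
  (g1_nc : nonconstant_on D1° g1) (g2_nc : nonconstant_on D2° g2)
  (D12_neq0 : D1 `&` D2 !=set0) :
  periodic_on (D1 `&` D2) (g1 \* g2) <-> commensurable T1 T2.
Proof.
have [T10 T20] : T1 != 0 /\ T2 != 0 by rewrite !gt_eqF.
split=> [[T pT]|[_ _ /rationalP[m [n T12]]]]; last first.
  (* Since [0^-1 = 0], a zero denominator would make [T1 / T2] vanish. *)
  have n0 : n != 0%N.
    apply: contra_eq_neq T12 => ->.
    by rewrite invr0 mulr0 mulf_neq0// invr_neq0.
  have nR0 : n%:R != 0 :> R by rewrite pnatr_eq0.
  have mn : n%:~R * T1 = m%:~R * T2.
    by rewrite -[T1](divfK T20) T12; field.
  have m0 : m != 0.
    by apply: contra_eq_neq mn => ->; rewrite mul0r mulf_neq0.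
  exists (n%:~R * T1); apply: has_periodM; first exact: has_period_scale.
  by rewrite mn; exact: has_period_scale.
apply: contrapT => n12.
have cont (D : set R) (g : R -> R) : {within D, continuous g} ->
    forall x, D° x -> {for x, continuous g}.
  move=> cg x Dx.
  have := continuous_subspaceW (@interior_subset _ D) cg.
  by rewrite continuous_open_subspace; [apply; rewrite inE|exact: open_interior].
have := has_period_interior pT; rewrite interiorI => pTi.
have p1 := has_period_interior g1_per; have p2 := has_period_interior g2_per.
have n21 : ~ commensurable T2 T1 by move=> /commensurable_sym.
(* By transitivity [T] cannot be commensurable with both periods, so one of the two orders of the
   factors fits. *)
have [cT1|nT1] := pselect (commensurable T T1); last first.
  by apply: (open_product_not_periodic T1_gt0 _ _ (cont _ _ g1_cont)
    (cont _ _ g2_cont) g1_nc g2_nc p1 p2 n12 nT1 pTi); exact: open_interior.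
have nT2 : ~ commensurable T T2.
  by move=> cT2; apply: n12; exact: commensurable_trans (commensurable_sym cT1) cT2.
apply: (open_product_not_periodic T2_gt0 _ _ (cont _ _ g2_cont)
    (cont _ _ g1_cont) g2_nc g1_nc p2 p1 n21 nT2); try exact: open_interior.
exact: has_periodMC.
Qed.
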